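(* Let $q_1,q_2,Y_1,Y_2,\rho>0$ and initial prices $p_{1,0},p_{2,0}>0$ satisfy $p_{2,0}q_2<p_{1,0}q_1$, and suppose $(Y_1,Y_2)$ lies in zone IV: $p_{1,0}q_1\le Y_1$, $0<Y_2<p_{2,0}q_2$. Zone IV is divided into: Zone IV-1: $p_{1,0}q_1\le Y_1$, $0<Y_2<p_{2,0}q_2$, $q_1\le\frac{1}{p_{1,0}}\Big[Y_1-p_{2,0}'\Big(q_2-\frac{Y_2}{p_{2,0}}\Big)\Big]$ (above or on $\ell_{3,0}$); Zone IV-2: $p_{1,0}q_1\le Y_1$, $0<Y_2<p_{2,0}q_2$, $q_1>\frac{1}{p_{1,0}}\Big[Y_1-p_{2,0}'\Big(q_2-\frac{Y_2}{p_{2,0}}\Big)\Big]$ (strictly below $\ell_{3,0}$). Write $\Delta p=p_{1,0}-p_{2,0}$. Then: a) In zone IV-1 there exists a unique NE, $\Big(q_1,q_2-\frac{Y_2}{p_{2,0}},0,\frac{Y_2}{p_{2,0}}\Big)$. Either $(Y_1,Y_2)\in\ell_{3,0}$, which is a p.e., or $(Y_1,Y_2)$ is strictly above $\ell_{3,0}$, and then after one upward adjustment in $p_{1,0}$ we obtain $(Y_1,Y_2)\in\ell_{3,1}$ (the p.e. obtained in this case is called an $\ell_3$-equilibrium). b) In zone IV-2 there exist two types of NE: I) for $\Delta p\le\rho$: $\Big(q_1,\frac{Y_1-p_{1,0}q_1}{p_{2,0}'},0,\frac{Y_2}{p_{2,0}}\Big)$; II) for $\Delta p>\rho$: $\Big(\frac{Y_1-p_{2,0}'(q_2-Y_2/p_{2,0})}{p_{1,0}},q_2-\frac{Y_2}{p_{2,0}},0,\frac{Y_2}{p_{2,0}}\Big)$.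 The corresponding price adjustment patterns are as follows. In case II): 1) when $(Y_1,Y_2)$ is strictly above $\ell_{2,0}$, after one downward adjustment step in $p_{1,0}$ an $\ell_3$-equilibrium is reached; 2) when $(Y_1,Y_2)$ lies on $\ell_{2,0}$, the price $p_{1,0}$ is reduced to $p_{1,1}=0$ and a degenerate $\ell_2$-equilibrium is reached. In case I): 1) when $Y_1=p_{1,0}q_1$, after one downward adjustment in $p_{2,0}$ a p.e. of type $E$ is reached; 2) when $Y_1>p_{1,0}q_1$, let $$k=\frac1{2q_2}\Big[\sqrt{(\rho q_2-Y_1-Y_2+p_{1,0}q_1)^2+4q_2\rho Y_2}-(\rho q_2-Y_1-Y_2+p_{1,0}q_1)\Big];$$ then, depending on whether 2.1) $p_{1,0}-\rho\le k<p_{2,0}$ or 2.2) $k<p_{1,0}-\rho<p_{2,0}$, we have respectively: in 2.1), an infinite downward adjustment process in $p_{2,t}$ for which $\lim_{t\to\infty}p_{2,t}=k$ (the system of two economies tends to a degenerate $\ell_3$-equilibrium, with limit line $\ell_{3,\infty}:\ \frac{k}{k+\rho}\tilde Y_1+\tilde Y_2=kq_2+\frac{k}{k+\rho}p_{1,0}q_1$); in 2.2), after $s$ downward adjustments of the second price, the situation described in case II) is reached; here the number $s\in\mathbb N$ is determined by the condition $p_{1,0}-\rho\in\big[g^s(p_{2,0}),g^{s-1}(p_{2,0})\big]$, where $g(x)=\frac1{q_2}\big[Y_2+(Y_1-p_{1,0}q_1)\frac{x}{x+\rho}\big]$ and $g^s$ is the $s$-fold iterate of $g$.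
   Context: Model. Fix $q_1,q_2>0$ (quantities supplied each period in regions I and II), $Y_1,Y_2>0$ (per-period incomes of consumers I and II) and $\rho>0$ (transportation cost). For prices $p_1,p_2\ge 0$ write $p_i'=p_i+\rho$ (and $p_{i,t}'=p_{i,t}+\rho$). In each period the following game is played. Consumer I chooses $(\alpha,\beta)\in S_1=\{\alpha,\beta\ge0,\ \alpha p_1+\beta p_2'\le Y_1\}$ (orders in regions I and II); consumer II chooses $(\gamma,\delta)\in S_2=\{\gamma,\delta\ge0,\ \gamma p_1'+\delta p_2\le Y_2\}$ (orders in regions I and II). Payoffs: $P_1=\min(\alpha,q_1)+\min(\beta,\max(0,q_2-\delta))$ and $P_2=\min(\delta,q_2)+\min(\gamma,\max(0,q_1-\alpha))$. Selected best replies. Given $(\gamma,\delta)$, consumer I's best reply is the maximizer of $P_1$ over $S_1$ that among all maximizers minimizes the expenditure $p_1\alpha+p_2'\beta$, and among those has the largest home order $\alpha$; if $p_1=0$ the home order is instead set to $\alpha=q_1$. Given $(\alpha,\beta)$, consumer II's best reply is the maximizer of $P_2$ over $S_2$ that minimizes $p_1'\gamma+p_2\delta$, and among those has the largest home order $\delta$; if $p_2=0$ the home order is set to $\delta=q_2$. A Nash equilibrium (NE) at prices $(p_1,p_2)$ is a quadruple $(\alpha,\beta,\gamma,\delta)$ in which each consumer's orders are the selected best reply to the other's. The NEs in the claim are those at the initial prices. Price dynamics (discrete time). At time $t$, with prices $p_{1,t},p_{2,t}$ and corresponding NE $(\alpha,\beta,\gamma,\delta)$, put $q_1^{cons}=\alpha+\gamma$,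 $q_2^{cons}=\beta+\delta$, $Y_1^{res}=Y_1-p_{2,t}'\beta$, $Y_2^{res}=Y_2-p_{1,t}'\gamma$. If $q_i^{cons}<q_i$, then $p_{i,t+1}=p_{i,t}q_i^{cons}/q_i$ (downward adjustment); if $Y_i^{res}>p_{i,t}q_i$, then $p_{i,t+1}=Y_i^{res}/q_i$ (upward adjustment); otherwise $p_{i,t+1}=p_{i,t}$. Lines in the $(\tilde Y_1,\tilde Y_2)$-plane at prices $(p_1,p_2)$: $\ell_2:\ q_2=\frac{\tilde Y_1}{p_2'}+\frac{\tilde Y_2}{p_2}$; $\ell_3:\ p_1q_1+p_2'q_2=\tilde Y_1+\frac{p_2'}{p_2}\tilde Y_2$. The lines at time-$t$ prices are denoted $\ell_{i,t}$. A point is above (below) a line if the side containing $\tilde Y_1,\tilde Y_2$ is larger (smaller) than the other side. A point of equilibrium (p.e.) for prices is a pair $(p_1,p_2)$ whose NE satisfies $\alpha+\gamma=q_1$, $\beta+\delta=q_2$, $p_1\alpha+p_2'\beta=Y_1$, $p_1'\gamma+p_2\delta=Y_2$; then prices remain unchanged. A p.e. of type $E$ is a p.e. with $p_i=Y_i/q_i$, $i=1,2$, and NE $(q_1,0,0,q_2)$. An $\ell_3$-equilibrium is a p.e. with $p_1q_1\le Y_1$, $Y_2<p_2q_2$ and $(Y_1,Y_2)\in\ell_3$. A degenerate $\ell_2$-equilibrium is a p.e. with $p_1=0$, $p_2>0$ and $(Y_1,Y_2)\in\ell_2$. The system ''tends to'' a degenerate $\ell_3$-equilibrium with a given limit line if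 the prices converge through an infinite adjustment process and $(Y_1,Y_2)$ lies on the line obtained from $\ell_3$ at the limit prices.
   Formalization: In b) II) the NE is claimed only for points on or above ℓ_{2,0}, since strictly below it the displayed α is negative and infeasible; in 2.2), if p_{1,0}−ρ is a common endpoint of two consecutive intervals, s is the larger index, the smaller one leaving Δp=ρ. *)

(* Defs.v *)
From Stdlib Require Import Reals.
Local Open Scope R_scope.

Record economy := Economy {
  supply1 : R; supply2 : R;
  income1 : R; income2 : R;
  transport : R }.

Record prices := Prices { price1 : R; price2 : R }.

(* Prices of a good bought from the other region. *)
Definition price1' (E : economy) (p : prices) : R := price1 p + transport E.
Definition price2' (E : economy) (p : prices) : R := price2 p + transport E.

(* (alpha, beta): orders of consumer I in regions I and II;
   (gamma, delta): orders of consumer II in regions I and II. *)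
Record orders := Orders { alpha : R; beta : R; gamma : R; delta : R }.

(* The problem of one consumer once the other's orders are given, in terms of
   a home order h and a foreign order f.  The two consumers' problems are
   mirror images of each other, so both are instances of this one. *)
Record problem := Problem {
  budget : R;
  home_price : R;
  foreign_price : R;
  home_supply : R;
  foreign_left : R }.

Definition expenditure (c : problem) (h f : R) : R :=
  h * home_price c + f * foreign_price c.

Definition feasible (c : problem) (h f : R) : Prop :=
  0 <= h /\ 0 <= f /\ expenditure c h f <= budget c.

Definition payoff (c : problem) (h f : R) : R :=
  Rmin h (home_supply c) + Rmin f (foreign_left c).

Definition maximizer (c : problem) (h f : R) : Prop :=
  feasible c h f /\
  forall h' f', feasible c h' f' -> payoff c h' f' <= payoff c h f.

Definition cheapest_maximizer (c : problem) (h f : R) : Prop :=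
  maximizer c h f /\
  forall h' f', maximizer c h' f' -> expenditure c h f <= expenditure c h' f'.

(* At home price 0 arbitrarily large home orders are cheapest maximizers, so
   there is no largest one; the home order is then the home supply. *)
Definition best_reply (c : problem) (h f : R) : Prop :=
  cheapest_maximizer c h f /\
  (home_price c = 0 -> h = home_supply c) /\
  (home_price c <> 0 ->
   forall h' f', cheapest_maximizer c h' f' -> h' <= h).

Definition problem1 (E : economy) (p : prices) (x : orders) : problem :=
  Problem (income1 E) (price1 p) (price2' E p) (supply1 E)
          (Rmax 0 (supply2 E - delta x)).

Definition problem2 (E : economy) (p : prices) (x : orders) : problem :=
  Problem (income2 E) (price2 p) (price1' E p) (supply2 E)
          (Rmax 0 (supply1 E - alpha x)).

Definition NE (E : economy) (p : prices) (x : orders) : Prop :=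
  best_reply (problem1 E p x) (alpha x) (beta x) /\
  best_reply (problem2 E p x) (delta x) (gamma x).

(* At an NE the downward and upward conditions exclude each other (a consumer
   with residual income above [price * supply] has ordered the whole home
   supply), so the order of the two tests is immaterial. *)
Definition adjust (price supply consumed residual : R) : R :=
  if Rlt_dec consumed supply then price * consumed / supply
  else if Rlt_dec (price * supply) residual then residual / supply
  else price.

Definition next_prices (E : economy) (p : prices) (x : orders) : prices :=
  Prices
    (adjust (price1 p) (supply1 E) (alpha x + gamma x)
            (income1 E - price2' E p * beta x))
    (adjust (price2 p) (supply2 E) (beta x + delta x)
            (income2 E - price1' E p * gamma x)).

Definition price_step (E : economy) (p p' : prices) : Prop :=
  exists x, NE E p x /\ p' = next_prices E p x.

Definition price_path (E : economy) (n : nat) (p0 : prices)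
    (p : nat -> prices) : Prop :=
  p 0%nat = p0 /\ forall t, (t < n)%nat -> price_step E (p t) (p (S t)).

Definition infinite_price_path (E : economy) (p0 : prices)
    (p : nat -> prices) : Prop :=
  p 0%nat = p0 /\ forall t, price_step E (p t) (p (S t)).

(* The existence halves of the next three definitions keep the universal
   halves from holding vacuously. *)
Definition after_one_step (E : economy) (p0 : prices)
    (Q : prices -> Prop) : Prop :=
  (exists p', price_step E p0 p') /\ forall p', price_step E p0 p' -> Q p'.

Definition after_steps (E : economy) (n : nat) (p0 : prices)
    (Q : (nat -> prices) -> Prop) : Prop :=
  (exists p, price_path E n p0 p) /\ forall p, price_path E n p0 p -> Q p.

Definition along_infinite_path (E : economy) (p0 : prices)
    (Q : (nat -> prices) -> Prop) : Prop :=
  (exists p, infinite_price_path E p0 p) /\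
  forall p, infinite_price_path E p0 p -> Q p.

Definition upward1 (p p' : prices) : Prop :=
  price1 p < price1 p' /\ price2 p' = price2 p.
Definition downward1 (p p' : prices) : Prop :=
  price1 p' < price1 p /\ price2 p' = price2 p.
Definition downward2 (p p' : prices) : Prop :=
  price1 p' = price1 p /\ price2 p' < price2 p.

Definition on_l2 (E : economy) (p : prices) (z1 z2 : R) : Prop :=
  supply2 E = z1 / price2' E p + z2 / price2 p.
Definition above_l2 (E : economy) (p : prices) (z1 z2 : R) : Prop :=
  supply2 E < z1 / price2' E p + z2 / price2 p.

Definition on_l3 (E : economy) (p : prices) (z1 z2 : R) : Prop :=
  price1 p * supply1 E + price2' E p * supply2 E
  = z1 + price2' E p / price2 p * z2.
Definition above_l3 (E : economy) (p : prices) (z1 z2 : R) : Prop :=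
  price1 p * supply1 E + price2' E p * supply2 E
  < z1 + price2' E p / price2 p * z2.

Definition clears (E : economy) (p : prices) (x : orders) : Prop :=
  alpha x + gamma x = supply1 E /\
  beta x + delta x = supply2 E /\
  price1 p * alpha x + price2' E p * beta x = income1 E /\
  price1' E p * gamma x + price2 p * delta x = income2 E.

Definition equilibrium_point (E : economy) (p : prices) : Prop :=
  0 <= price1 p /\ 0 <= price2 p /\
  exists x, unique (NE E p) x /\ clears E p x.

Definition equilibrium_E (E : economy) (p : prices) : Prop :=
  equilibrium_point E p /\
  price1 p = income1 E / supply1 E /\
  price2 p = income2 E / supply2 E /\
  unique (NE E p) (Orders (supply1 E) 0 0 (supply2 E)).

Definition l3_equilibrium (E : economy) (p : prices) : Prop :=
  equilibrium_point E p /\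
  price1 p * supply1 E <= income1 E /\
  income2 E < price2 p * supply2 E /\
  on_l3 E p (income1 E) (income2 E).

Definition degenerate_l2_equilibrium (E : economy) (p : prices) : Prop :=
  equilibrium_point E p /\
  price1 p = 0 /\ 0 < price2 p /\
  on_l2 E p (income1 E) (income2 E).

Definition tends_to_degenerate_l3_equilibrium (E : economy)
    (p : nat -> prices) (lim : prices) : Prop :=
  (forall t, p (S t) <> p t) /\
  Un_cv (fun t => price1 (p t)) (price1 lim) /\
  Un_cv (fun t => price2 (p t)) (price2 lim) /\
  on_l3 E lim (income1 E) (income2 E).

Definition zone_IV (E : economy) (p : prices) : Prop :=
  price1 p * supply1 E <= income1 E /\
  0 < income2 E < price2 p * supply2 E.

Definition zone_IV_1 (E : economy) (p : prices) : Prop :=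
  zone_IV E p /\
  supply1 E <= 1 / price1 p *
    (income1 E - price2' E p * (supply2 E - income2 E / price2 p)).

Definition zone_IV_2 (E : economy) (p : prices) : Prop :=
  zone_IV E p /\
  supply1 E > 1 / price1 p *
    (income1 E - price2' E p * (supply2 E - income2 E / price2 p)).

(* Cases I and II, together with the standing assumptions on the prices. *)
Definition case_I (E : economy) (p : prices) : Prop :=
  0 < price1 p /\ 0 < price2 p /\
  price2 p * supply2 E < price1 p * supply1 E /\
  zone_IV_2 E p /\ price1 p - price2 p <= transport E.

Definition case_II (E : economy) (p : prices) : Prop :=
  0 < price1 p /\ 0 < price2 p /\
  price2 p * supply2 E < price1 p * supply1 E /\
  zone_IV_2 E p /\ price1 p - price2 p > transport E.

(* Main.v *)
Require Import Defs.
From Stdlib Require Import Reals Lra Lia.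
Local Open Scope R_scope.

(** Why the theorem holds.

    Each consumer solves a small linear program: fill a box (home supply by
    what the other leaves abroad) under a budget.  Its solution is greedy: buy
    the cheaper good first.  Optimality of a greedy bundle is certified by a
    shadow price [supported_cheapest_maximizer], and the selection rule makes
    the best reply unique [best_reply_unique], so a Nash equilibrium is known
    as soon as one best reply is exhibited for each consumer.

    In zone IV consumer II always spends the whole income at home.  Either
    [price1 <= price2'], and then consumer I buys out region I and leaves
    nothing there for II, or [price2 < price1'], and then II prefers the home
    good, whose supply exceeds what the income buys.  Hence the Nash equilibria
    are exactly the best replies of consumer I to
    [delta = income2 / price2] [unique_NE_zone_IV], and the position of the
    incomes relative to [l3] and [l2], together with the order of [price1] and
    [price2'], says which greedy bundle that is.  The argument extends to the
    boundary cases [price1 = 0] and [income2 = price2 * supply2]; this is why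
    one lemma, [equilibrium_on_l3], handles all three kinds of equilibrium
    points that the dynamics reaches: [l3], degenerate [l2] and type [E].

    Above [l3], or in case II, one adjustment replaces [price1] by the price
    that makes consumer I spend exactly the income left over from region II on
    the whole supply of region I, which is the equation of [l3] at the new
    prices [l3_reached].

    In case I only [price2] moves, by [x |-> next_price2 x].  If consumer I
    spends everything at home the map is constant, with value
    [income2 / supply2], and one step leads to type [E].  Otherwise its positive
    fixed point is [k], and being strictly below [l3] at [price2 = x] means
    [next_price2 x < x] [below_l3_next_price2].  The identity
    [next_price2_minus_fixpoint] makes the map a contraction towards [k] on the
    prices above [k], so the orbit decreases to [k] for as long as case I
    lasts, that is, as long as [price1 - x <= transport].  If
    [price1 - transport <= k] this is forever; otherwise the orbit falls below
    [price1 - transport] after finitely many steps, and the first time it does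
    the prices are in case II. *)

(** * Best replies of one consumer *)

(** The selection rule fixes the home order; equal expenditure then fixes the
    foreign order. *)
Lemma best_reply_unique c h f h' f' :
  foreign_price c <> 0 ->
  best_reply c h f -> best_reply c h' f' -> h = h' /\ f = f'.
Proof.
  intros Hf [[M C] [Z L]] [[M' C'] [Z' L']].
  assert (Eh : h = h').
  { destruct (Req_dec (home_price c) 0) as [H0 | H0].
    - now rewrite Z, Z'.
    - apply Rle_antisym; [apply (L' H0 h f) | apply (L H0 h' f')]; now split. }
  subst h'. split; [reflexivity |].
  pose proof (C _ _ M') as H1. pose proof (C' _ _ M) as H2.
  unfold expenditure in H1, H2.
  apply (Rmult_eq_reg_r (foreign_price c)); [lra | assumption].
Qed.

(** Orders beyond the available quantities cost money without raising the
    payoff, so bundles can be compared inside the box, where the payoff is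
    linear. *)
Lemma truncation c h f :
  0 <= home_price c -> 0 <= foreign_price c ->
  0 <= home_supply c -> 0 <= foreign_left c -> feasible c h f ->
  exists a b,
    0 <= a <= home_supply c /\ 0 <= b <= foreign_left c /\
    a <= h /\ b <= f /\ payoff c h f = a + b /\
    expenditure c a b <= expenditure c h f.
Proof.
  intros Hh Hf Hs Hl (H0 & F0 & _).
  exists (Rmin h (home_supply c)), (Rmin f (foreign_left c)).
  pose proof (Rmin_l h (home_supply c)). pose proof (Rmin_r h (home_supply c)).
  pose proof (Rmin_l f (foreign_left c)). pose proof (Rmin_r f (foreign_left c)).
  pose proof (Rmin_glb _ _ _ H0 Hs). pose proof (Rmin_glb _ _ _ F0 Hl).
  unfold payoff, expenditure. repeat split; try assumption; nra.
Qed.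

Lemma payoff_in_box c h f :
  h <= home_supply c -> f <= foreign_left c -> payoff c h f = h + f.
Proof. intros; unfold payoff; rewrite !Rmin_left; trivial. Qed.

Lemma saturated_best_reply c :
  0 <= home_price c -> 0 < foreign_price c ->
  0 <= home_supply c -> 0 <= foreign_left c ->
  expenditure c (home_supply c) (foreign_left c) <= budget c ->
  best_reply c (home_supply c) (foreign_left c).
Proof.
  intros Hh Hf Hs Hl Hb.
  assert (M : maximizer c (home_supply c) (foreign_left c)).
  { split; [now repeat split |]. intros h f Hhf.
    rewrite (payoff_in_box c (home_supply c) (foreign_left c)) by apply Rle_refl.
    unfold payoff.
    pose proof (Rmin_r h (home_supply c)). pose proof (Rmin_r f (foreign_left c)).
    lra. }
  assert (B : forall h f, maximizer c h f ->
    home_supply c <= h /\ foreign_left c <= f).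
  { intros h f [F Mx]. specialize (Mx _ _ (proj1 M)).
    rewrite (payoff_in_box c (home_supply c) (foreign_left c)) in Mx
      by apply Rle_refl.
    destruct (truncation c h f) as (a & b & ? & ? & ? & ? & Ep & _);
      try lra; trivial. }
  assert (C : cheapest_maximizer c (home_supply c) (foreign_left c)).
  { split; [exact M |]. intros h f Mx. destruct (B _ _ Mx).
    unfold expenditure. nra. }
  split; [exact C |]. split; [reflexivity |].
  intros H0 h f [Mx Cx]. destruct (B _ _ Mx) as [_ ?].
  specialize (Cx _ _ M). unfold expenditure in Cx.
  apply (Rmult_le_reg_r (home_price c)); nra.
Qed.

(** Linear-programming duality: [v] is the marginal cost of utility.  The two
    sign conditions say that [(x, y)] minimizes [cost - v * payoff] over the
    box.  Hence a bundle whose cost is within the budget cannot have a larger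
    payoff, and one with the same payoff cannot cost less.  The second half
    records where the other cheapest maximizers can lie, which is what is
    needed to pick the one with the largest home order. *)
Lemma supported_cheapest_maximizer c v x y :
  0 < home_price c -> 0 < foreign_price c ->
  0 <= x <= home_supply c -> 0 <= y <= foreign_left c ->
  expenditure c x y = budget c -> 0 < v ->
  (forall a, 0 <= a <= home_supply c -> 0 <= (home_price c - v) * (a - x)) ->
  (forall b, 0 <= b <= foreign_left c -> 0 <= (foreign_price c - v) * (b - y)) ->
  cheapest_maximizer c x y /\
  forall h f, cheapest_maximizer c h f ->
    0 <= h <= home_supply c /\ 0 <= f <= foreign_left c /\
    h + f = x + y /\ expenditure c h f = budget c.
Proof.
  intros Hh Hf Hx Hy Hb Hv Sx Sy.
  assert (M : maximizer c x y).
  { split; [unfold feasible; lra |]. intros h f F.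
    rewrite (payoff_in_box c x y) by lra.
    destruct (truncation c h f) as (a & b & Ha & Hb' & _ & _ & Ep & Ex);
      try lra; trivial.
    destruct F as (_ & _ & F). rewrite Ep.
    specialize (Sx a Ha). specialize (Sy b Hb').
    unfold expenditure in *. nra. }
  assert (L : forall h f, maximizer c h f -> exists a b,
    0 <= a <= home_supply c /\ 0 <= b <= foreign_left c /\
    a <= h /\ b <= f /\ a + b = x + y /\
    budget c <= expenditure c a b <= expenditure c h f).
  { intros h f [F Mx].
    destruct (truncation c h f) as (a & b & Ha & Hb' & Hah & Hbf & Ep & Ex);
      try lra; trivial.
    exists a, b.
    pose proof (Mx _ _ (proj1 M)) as P1. pose proof (proj2 M _ _ F) as P2.
    rewrite (payoff_in_box c x y) in P1, P2 by lra.
    specialize (Sx a Ha). specialize (Sy b Hb').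
    repeat split; try lra. unfold expenditure in *. nra. }
  split.
  - split; [exact M |]. intros h f Mx.
    destruct (L _ _ Mx) as (a & b & ? & ? & ? & ? & ? & ?). lra.
  - intros h f [Mx Cx]. specialize (Cx _ _ M).
    destruct (L _ _ Mx) as (a & b & Ha & Hb' & Hah & Hbf & Es & Ee).
    (* Truncating saved nothing, and both prices are positive. *)
    assert (h = a /\ f = b) as [-> ->].
    { unfold expenditure in *. split; nra. }
    repeat split; lra.
Qed.

(** The shadow price is that of the good bought at the margin: the foreign one
    if the home supply is exhausted, the home one if nothing is bought
    abroad. *)
Lemma home_first_best_reply c x y :
  0 < home_price c <= foreign_price c ->
  0 <= x <= home_supply c -> 0 <= y <= foreign_left c ->
  expenditure c x y = budget c -> x = home_supply c \/ y = 0 ->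
  best_reply c x y.
Proof.
  intros Hh Hx Hy Hb D.
  assert (S : cheapest_maximizer c x y /\
    forall h f, cheapest_maximizer c h f ->
      0 <= h <= home_supply c /\ 0 <= f <= foreign_left c /\
      h + f = x + y /\ expenditure c h f = budget c).
  { destruct D as [D | D];
      [apply (supported_cheapest_maximizer c (foreign_price c))
      |apply (supported_cheapest_maximizer c (home_price c))];
      try lra; intros; nra. }
  destruct S as [C S]. split; [exact C |]. split; [lra |].
  intros _ h f Chf. destruct (S _ _ Chf). lra.
Qed.

(** Mirror image of the home-first bundle; here the strict price order leaves
    no tie for the largest-home-order rule to break. *)
Lemma foreign_first_best_reply c x y :
  0 < foreign_price c < home_price c ->
  0 <= x <= home_supply c -> 0 <= y <= foreign_left c ->
  expenditure c x y = budget c -> x = 0 \/ y = foreign_left c ->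
  best_reply c x y.
Proof.
  intros Hh Hx Hy Hb D.
  assert (S : cheapest_maximizer c x y /\
    forall h f, cheapest_maximizer c h f ->
      0 <= h <= home_supply c /\ 0 <= f <= foreign_left c /\
      h + f = x + y /\ expenditure c h f = budget c).
  { destruct D as [D | D];
      [apply (supported_cheapest_maximizer c (foreign_price c))
      |apply (supported_cheapest_maximizer c (home_price c))];
      try lra; intros; nra. }
  destruct S as [C S]. split; [exact C |]. split; [lra |].
  intros _ h f Chf. destruct (S _ _ Chf) as (_ & _ & ? & ?).
  unfold expenditure in *. nra.
Qed.

(** This decouples the two consumers: the home order is determined before
    anything is known about the other's orders, which only enter through
    [foreign_left]. *)
Lemma home_supply_bought c x y :
  0 <= home_price c <= foreign_price c -> 0 < foreign_price c ->
  0 <= home_supply c -> 0 <= foreign_left c ->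
  home_price c * home_supply c <= budget c ->
  best_reply c x y -> x = home_supply c.
Proof.
  intros Hh Hf Hs Hl Hb B.
  destruct (Req_dec (home_price c) 0) as [H0 | H0];
    [exact (proj1 (proj2 B) H0) |].
  destruct (Rle_or_lt (expenditure c (home_supply c) (foreign_left c)) (budget c))
    as [A | A].
  - apply (best_reply_unique c x y _ (foreign_left c)); trivial; [lra |].
    apply saturated_best_reply; lra.
  - set (r := (budget c - home_price c * home_supply c) / foreign_price c).
    assert (Er : r * foreign_price c = budget c - home_price c * home_supply c)
      by (unfold r; field; lra).
    unfold expenditure in A.
    apply (best_reply_unique c x y _ r); trivial; [lra |].
    apply home_first_best_reply; try lra; [| unfold expenditure; lra].
    split; [apply Rmult_le_pos; [lra | apply Rlt_le, Rinv_0_lt_compat; lra] |].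
    apply (Rmult_le_reg_r (foreign_price c)); lra.
Qed.

(** The second alternative covers the case in which the foreign good is cheaper
    but sold out. *)
Lemma budget_spent_at_home c :
  0 < home_price c -> 0 < foreign_price c -> 0 <= foreign_left c ->
  0 <= budget c <= home_price c * home_supply c ->
  home_price c <= foreign_price c \/ foreign_left c = 0 ->
  best_reply c (budget c / home_price c) 0.
Proof.
  intros Hh Hf Hl Hb D.
  assert (Ex : budget c / home_price c * home_price c = budget c) by (field; lra).
  assert (Bx : 0 <= budget c / home_price c <= home_supply c).
  { split; apply (Rmult_le_reg_r (home_price c)); lra. }
  destruct (Rle_or_lt (home_price c) (foreign_price c)).
  - apply home_first_best_reply; unfold expenditure; lra.
  - apply foreign_first_best_reply; unfold expenditure; lra.
Qed.

(** * Nash equilibria in zone IV *)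

Definition positive_economy (E : economy) : Prop :=
  0 < supply1 E /\ 0 < supply2 E /\ 0 < income2 E /\ 0 < transport E.

(** The closure of zone IV, with [price1 = 0] admitted: the equilibrium points
    of type [E] and the degenerate [l2] ones lie on its boundary. *)
Definition closed_zone_IV (E : economy) (p : prices) : Prop :=
  0 <= price1 p /\ 0 < price2 p /\
  price1 p * supply1 E <= income1 E /\ income2 E <= price2 p * supply2 E.

(** What consumer II leaves in region II after spending the whole income
    there.  In terms of it [l2] and [l3] say that the income of consumer I
    exactly pays for the leftover, without or with the supply of region I. *)
Definition leftover2 (E : economy) (p : prices) : R :=
  supply2 E - income2 E / price2 p.

Lemma leftover2_bounds E p :
  positive_economy E -> closed_zone_IV E p -> 0 <= leftover2 E p <= supply2 E.
Proof.
  intros (? & ? & ? & ?) (? & ? & ? & ?). unfold leftover2.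
  assert (income2 E / price2 p * price2 p = income2 E) by (field; lra).
  split; apply (Rmult_le_reg_r (price2 p)); nra.
Qed.

(** Consumer II spends everything at home: if [price1 <= price2'], region I is
    sold out to consumer I; otherwise [price2 < price1'] and the home good is
    the cheaper one.  So the equilibria are the best replies of consumer I to
    this known order. *)
Lemma unique_NE_zone_IV E p a b :
  positive_economy E -> closed_zone_IV E p ->
  best_reply (Problem (income1 E) (price1 p) (price2' E p) (supply1 E) (leftover2 E p))
    a b ->
  unique (NE E p) (Orders a b 0 (income2 E / price2 p)).
Proof.
  intros HE Hp B.
  pose proof (leftover2_bounds E p HE Hp) as HR.
  destruct HE as (? & ? & ? & ?). destruct Hp as (? & ? & ? & ?).
  unfold price2' in B.
  (* When [price2 > price1'] the home good is the dearer one for II, and II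
     orders it only because region I is then sold out. *)
  assert (P2 : forall x,
    (price1 p <= price2 p + transport E -> alpha x = supply1 E) ->
    best_reply (problem2 E p x) (income2 E / price2 p) 0).
  { intros x Hx.
    apply (budget_spent_at_home (problem2 E p x)); cbn; unfold price1'; try lra.
    - apply Rmax_l.
    - destruct (Rle_or_lt (price1 p) (price2 p + transport E)) as [L | L].
      + right. rewrite Hx by assumption. rewrite Rmax_left; lra.
      + left. lra. }
  assert (P1 : forall x, delta x = income2 E / price2 p ->
    problem1 E p x = Problem (income1 E) (price1 p)
      (price2 p + transport E) (supply1 E) (leftover2 E p)).
  { intros x Dx. unfold problem1, price2', leftover2 in *. rewrite Dx.
    rewrite Rmax_right by lra. reflexivity. }
  split.
  - split.
    + rewrite P1 by reflexivity. exact B.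
    + apply P2. intros L. cbn.
      apply (home_supply_bought _ _ _) in B; cbn in *; lra.
  - intros [a' b' c' d'] [B1 B2]. cbn in B1, B2.
    assert (B2' : best_reply (problem2 E p (Orders a' b' c' d'))
      (income2 E / price2 p) 0).
    { apply P2. intros L. apply home_supply_bought in B1; cbn in *;
        unfold price2'; try lra. apply Rmax_l. }
    edestruct best_reply_unique with (2 := B2) (3 := B2') as [Hd Hc];
      [cbn; unfold price1'; lra |].
    rewrite P1 in B1 by (cbn; congruence).
    edestruct best_reply_unique with (2 := B1) (3 := B);
      [cbn; lra | congruence].
Qed.

Lemma unique_NE_above_l3 E p :
  positive_economy E -> closed_zone_IV E p ->
  price1 p * supply1 E + price2' E p * leftover2 E p <= income1 E ->
  unique (NE E p)
    (Orders (supply1 E) (leftover2 E p) 0 (income2 E / price2 p)).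
Proof.
  intros HE Hp L. apply unique_NE_zone_IV; trivial.
  pose proof (leftover2_bounds E p HE Hp).
  destruct HE as (? & ? & ? & ?). destruct Hp as (? & ? & ? & ?).
  unfold price2' in *.
  apply (saturated_best_reply
    (Problem (income1 E) (price1 p) (price2 p + transport E) (supply1 E) (leftover2 E p)));
    unfold expenditure; cbn; lra.
Qed.

Lemma unique_NE_case_I E p :
  positive_economy E -> closed_zone_IV E p ->
  0 < price1 p <= price2' E p ->
  income1 E < price1 p * supply1 E + price2' E p * leftover2 E p ->
  unique (NE E p)
    (Orders (supply1 E) ((income1 E - price1 p * supply1 E) / price2' E p)
      0 (income2 E / price2 p)).
Proof.
  intros HE Hp H1 L. apply unique_NE_zone_IV; trivial.
  pose proof (leftover2_bounds E p HE Hp).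
  destruct HE as (? & ? & ? & ?). destruct Hp as (? & ? & ? & ?).
  set (b := (income1 E - price1 p * supply1 E) / price2' E p).
  assert (Eb : b * price2' E p = income1 E - price1 p * supply1 E)
    by (unfold b; field; lra).
  apply home_first_best_reply; unfold expenditure; cbn; try lra.
  split; apply (Rmult_le_reg_r (price2' E p)); lra.
Qed.

Lemma unique_NE_case_II E p :
  positive_economy E -> closed_zone_IV E p ->
  price2' E p < price1 p ->
  price2' E p * leftover2 E p <= income1 E <
    price1 p * supply1 E + price2' E p * leftover2 E p ->
  unique (NE E p)
    (Orders ((income1 E - price2' E p * leftover2 E p) / price1 p) (leftover2 E p)
      0 (income2 E / price2 p)).
Proof.
  intros HE Hp H1 L. apply unique_NE_zone_IV; trivial.
  pose proof (leftover2_bounds E p HE Hp).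
  destruct HE as (? & ? & ? & ?). destruct Hp as (? & ? & ? & ?).
  unfold price2' in *.
  set (a := (income1 E - (price2 p + transport E) * leftover2 E p) / price1 p).
  assert (Ea : a * price1 p = income1 E - (price2 p + transport E) * leftover2 E p)
    by (unfold a; field; lra).
  apply foreign_first_best_reply; unfold expenditure; cbn; try lra.
  split; apply (Rmult_le_reg_r (price1 p)); lra.
Qed.

(** * Positions relative to the lines *)

Lemma below_l3_zone_IV_2 E p :
  0 < price1 p ->
  supply1 E > 1 / price1 p *
    (income1 E - price2' E p * (supply2 E - income2 E / price2 p)) <->
  income1 E < price1 p * supply1 E + price2' E p * leftover2 E p.
Proof.
  intros Hp. fold (leftover2 E p).
  set (m := income1 E - price2' E p * leftover2 E p).
  assert (1 / price1 p * m * price1 p = m) by (field; lra).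
  unfold m in *; split; intros; nra.
Qed.

Lemma on_l3_leftover2 E p :
  0 < price2 p ->
  (on_l3 E p (income1 E) (income2 E) <->
   price1 p * supply1 E + price2' E p * leftover2 E p = income1 E).
Proof.
  intros H. unfold on_l3, leftover2.
  replace (price2' E p / price2 p * income2 E)
    with (price2' E p * (income2 E / price2 p)) by (field; lra).
  lra.
Qed.

Lemma above_l3_leftover2 E p :
  0 < price2 p ->
  above_l3 E p (income1 E) (income2 E) <->
  price1 p * supply1 E + price2' E p * leftover2 E p < income1 E.
Proof.
  intros H. unfold above_l3, leftover2.
  replace (price2' E p / price2 p * income2 E)
    with (price2' E p * (income2 E / price2 p)) by (field; lra).
  lra.
Qed.

Lemma on_l2_leftover2 E p :
  0 < price2' E p ->
  on_l2 E p (income1 E) (income2 E) <-> price2' E p * leftover2 E p = income1 E.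
Proof.
  intros H. unfold on_l2, leftover2.
  assert (income1 E / price2' E p * price2' E p = income1 E) by (field; lra).
  split; intros G; [| apply (Rmult_eq_reg_r (price2' E p))]; nra.
Qed.

Lemma above_l2_leftover2 E p :
  0 < price2' E p ->
  above_l2 E p (income1 E) (income2 E) <-> price2' E p * leftover2 E p < income1 E.
Proof.
  intros H. unfold above_l2, leftover2.
  assert (income1 E / price2' E p * price2' E p = income1 E) by (field; lra).
  split; intros G; nra.
Qed.

(** * The price dynamics *)

Lemma adjust_down p s c r : c < s -> adjust p s c r = p * c / s.
Proof. intros; unfold adjust; destruct (Rlt_dec c s); [reflexivity | lra]. Qed.

Lemma adjust_up p s c r : c = s -> p * s < r -> adjust p s c r = r / s.
Proof.
  intros; unfold adjust; destruct (Rlt_dec c s); [lra |].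
  destruct (Rlt_dec (p * s) r); [reflexivity | lra].
Qed.

Lemma adjust_stay p s c r : c = s -> r <= p * s -> adjust p s c r = p.
Proof.
  intros; unfold adjust; destruct (Rlt_dec c s); [lra |].
  destruct (Rlt_dec (p * s) r); [lra | reflexivity].
Qed.

(** Uniqueness of the equilibrium makes the dynamics deterministic; every claim
    on all price paths then reduces to one explicit path. *)
Lemma price_step_unique_NE E p x p' :
  unique (NE E p) x -> price_step E p p' <-> p' = next_prices E p x.
Proof.
  intros [N U]. split.
  - intros (y & Ny & ->). now rewrite (U y Ny).
  - intros ->. now exists x.
Qed.

Lemma after_one_step_intro E p r (Q : prices -> Prop) :
  (forall p', price_step E p p' <-> p' = r) -> Q r -> after_one_step E p Q.
Proof.
  intros D HQ. split.
  - exists r. now apply D.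
  - intros p' H. apply D in H. now subst.
Qed.

Lemma price_path_determined E n (r p : nat -> prices) :
  (forall t, (t < n)%nat -> forall p', price_step E (r t) p' <-> p' = r (S t)) ->
  price_path E n (r 0%nat) p -> forall t, (t <= n)%nat -> p t = r t.
Proof.
  intros D [P0 PS]. induction t as [| t IH]; intros Ht; [exact P0 |].
  apply (D t); [lia |]. rewrite <- IH by lia. apply PS; lia.
Qed.

Lemma after_steps_intro E n (r : nat -> prices) (Q : (nat -> prices) -> Prop) :
  (forall t, (t < n)%nat -> forall p', price_step E (r t) p' <-> p' = r (S t)) ->
  (forall p, (forall t, (t <= n)%nat -> p t = r t) -> Q p) ->
  after_steps E n (r 0%nat) Q.
Proof.
  intros D HQ. split.
  - exists r. split; [reflexivity |]. intros t Ht. now apply D.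
  - intros p Hp. apply HQ. now apply (price_path_determined E).
Qed.

Lemma along_infinite_path_intro E (r : nat -> prices)
    (Q : (nat -> prices) -> Prop) :
  (forall t p', price_step E (r t) p' <-> p' = r (S t)) ->
  (forall p, (forall t, p t = r t) -> Q p) ->
  along_infinite_path E (r 0%nat) Q.
Proof.
  intros D HQ. split.
  - exists r. split; [reflexivity |]. intros t. now apply D.
  - intros p [P0 PS]. apply HQ. intros t.
    apply (price_path_determined E t); [intros; apply D | | lia].
    split; [exact P0 | intros; apply PS].
Qed.

(** Consumer I has income left after buying everything on offer, and all that
    was not spent in region II is matched with the supply of region I. *)
Lemma step_above_l3 E p p' :
  positive_economy E -> closed_zone_IV E p ->
  price1 p * supply1 E + price2' E p * leftover2 E p < income1 E ->
  price_step E p p' <->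
  p' = Prices ((income1 E - price2' E p * leftover2 E p) / supply1 E) (price2 p).
Proof.
  intros HE Hp L.
  rewrite (price_step_unique_NE _ _ _ _
    (unique_NE_above_l3 E p HE Hp (Rlt_le _ _ L))).
  destruct Hp as (? & ? & ? & ?). unfold next_prices; cbn.
  rewrite adjust_up, adjust_stay; unfold leftover2 in *; try lra. reflexivity.
Qed.

(** The same new price as above [l3], now lower than the old one: the income of
    consumer I not spent in region II buys less than the supply of region
    I. *)
Lemma step_case_II E p p' :
  positive_economy E -> closed_zone_IV E p ->
  price2' E p < price1 p ->
  price2' E p * leftover2 E p <= income1 E <
    price1 p * supply1 E + price2' E p * leftover2 E p ->
  price_step E p p' <->
  p' = Prices ((income1 E - price2' E p * leftover2 E p) / supply1 E) (price2 p).
Proof.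
  intros HE Hp H1 L.
  rewrite (price_step_unique_NE _ _ _ _ (unique_NE_case_II E p HE Hp H1 L)).
  destruct HE as (? & ? & ? & ?). destruct Hp as (? & ? & ? & ?).
  assert (0 < price1 p) by (unfold price2' in *; lra).
  unfold next_prices; cbn.
  rewrite adjust_down, adjust_stay; try (unfold leftover2; lra).
  - match goal with |- _ = Prices ?u _ <-> _ = Prices ?v _ =>
      replace u with v by (field; lra) end. reflexivity.
  - apply (Rmult_lt_reg_r (price1 p)); [lra |].
    rewrite Rplus_0_r. unfold Rdiv at 1. rewrite Rmult_assoc, Rinv_l; lra.
Qed.

(** The second price after an adjustment in case I from [price2 = x]: the sales
    of region II at market prices, divided by its supply.  The share
    [x / (x + transport)] is what remains of consumer I's expenditure there
    once transport is paid. *)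
Definition next_price2 (E : economy) (p1 x : R) : R :=
  1 / supply2 E *
    (income2 E + (income1 E - p1 * supply1 E) * (x / (x + transport E))).

(** Below [l3] not all of the supply of region II is bought, which is exactly
    when the market price falls. *)
Lemma below_l3_next_price2 E p :
  positive_economy E -> 0 < price2 p ->
  income1 E < price1 p * supply1 E + price2' E p * leftover2 E p <->
  next_price2 E (price1 p) (price2 p) < price2 p.
Proof.
  intros (? & ? & ? & ?) Hp. unfold next_price2, leftover2, price2'.
  set (x := price2 p) in *. set (r := transport E) in *.
  set (A := income1 E - price1 p * supply1 E).
  assert (G : (x - 1 / supply2 E * (income2 E + A * (x / (x + r))))
      * (supply2 E * (x + r))
    = (price1 p * supply1 E + (x + r) * (supply2 E - income2 E / x)
       - income1 E) * x).
  { unfold A. field. lra. }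
  assert (0 < supply2 E * (x + r)) by (apply Rmult_lt_0_compat; lra).
  split; intros; nra.
Qed.

Lemma step_case_I E p p' :
  positive_economy E -> closed_zone_IV E p ->
  0 < price1 p <= price2' E p ->
  income1 E < price1 p * supply1 E + price2' E p * leftover2 E p ->
  price_step E p p' <->
  p' = Prices (price1 p) (next_price2 E (price1 p) (price2 p)).
Proof.
  intros HE Hp H1 L.
  rewrite (price_step_unique_NE _ _ _ _ (unique_NE_case_I E p HE Hp H1 L)).
  destruct HE as (? & ? & ? & ?). destruct Hp as (? & ? & ? & ?).
  set (b := (income1 E - price1 p * supply1 E) / price2' E p).
  assert (Eb : b * price2' E p = income1 E - price1 p * supply1 E)
    by (unfold b; field; lra).
  unfold next_prices; cbn.
  rewrite adjust_stay, adjust_down; try lra.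
  - match goal with |- _ = Prices _ ?u <-> _ = Prices _ ?v =>
      replace u with v end; [reflexivity |].
    unfold next_price2, b, price2'. field. unfold price2' in *; lra.
  - assert (b < leftover2 E p)
      by (apply (Rmult_lt_reg_r (price2' E p)); lra).
    unfold leftover2 in *; lra.
Qed.

(** * The falling second price *)

Lemma limit_price_root q b c :
  0 < q -> 0 < c ->
  let k := 1 / (2 * q) * (sqrt (b ^ 2 + 4 * q * c) - b) in
  0 < k /\ q * k ^ 2 + b * k = c.
Proof.
  intros Hq Hc k.
  set (D := b ^ 2 + 4 * q * c) in *.
  assert (HD : b ^ 2 < D) by (unfold D; nra).
  assert (HS : sqrt D * sqrt D = D) by (apply sqrt_sqrt; nra).
  pose proof (sqrt_pos D).
  assert (Ek : sqrt D = 2 * q * k + b) by (unfold k; field; lra).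
  rewrite Ek in HS, H.
  assert (q * k ^ 2 + b * k = c) by (unfold D in HS; nra).
  split; [| assumption].
  assert (0 < 2 * q * k) by nra. nra.
Qed.

Lemma next_price2_minus_fixpoint E p1 k x :
  positive_economy E -> 0 < k -> next_price2 E p1 k = k -> 0 < x ->
  next_price2 E p1 x - k =
  (income1 E - p1 * supply1 E) * transport E
    / (supply2 E * (x + transport E) * (k + transport E)) * (x - k).
Proof.
  intros (? & ? & ? & ?) Hk Fk Hx. rewrite <- Fk at 1. unfold next_price2.
  field. lra.
Qed.

(** For [x > k] the factor in [next_price2_minus_fixpoint] is at most its value
    at [x = k].  That value is below 1 because the fixed-point equation gives
    [income1 - p1 * supply1 < supply2 * (k + transport)]: consumer II pays for
    a part of the supply of region II. *)
Lemma next_price2_contracts E p1 k :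
  positive_economy E -> p1 * supply1 E < income1 E ->
  0 < k -> next_price2 E p1 k = k ->
  exists c, 0 <= c < 1 /\ forall x, k < x ->
    k < next_price2 E p1 x /\ next_price2 E p1 x - k <= c * (x - k).
Proof.
  intros HE HA Hk Fk.
  pose proof (next_price2_minus_fixpoint E p1 k) as D.
  destruct HE as (H1 & H2 & H3 & H4).
  set (r := transport E) in *. set (q := supply2 E) in *.
  set (A := income1 E - p1 * supply1 E) in *.
  assert (0 < A) by (unfold A; lra).
  assert (HAk : A < q * (k + r)).
  { assert (A * k = (q * k - income2 E) * (k + r)).
    { unfold next_price2 in Fk. fold r q A in Fk.
      rewrite <- Fk at 2. field. lra. }
    nra. }
  exists (A * r / (q * (k + r) * (k + r))).
  assert (Hd : 0 < q * (k + r)) by nra.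
  split.
  - split.
    + apply Rlt_le, Rdiv_lt_0_compat; [nra |]. apply Rmult_lt_0_compat; lra.
    + apply (Rmult_lt_reg_r (q * (k + r) * (k + r)));
        [apply Rmult_lt_0_compat; lra |].
      unfold Rdiv. rewrite Rmult_assoc, Rinv_l; nra.
  - intros x Hx.
    specialize (D x (conj H1 (conj H2 (conj H3 H4))) Hk Fk ltac:(lra)).
    assert (Hdx : 0 < q * (x + r) * (k + r))
      by (repeat apply Rmult_lt_0_compat; lra).
    assert (0 < A * r) by nra.
    assert (0 < A * r / (q * (x + r) * (k + r)))
      by (apply Rdiv_lt_0_compat; assumption).
    split; [nra |].
    rewrite D. apply Rmult_le_compat_r; [lra |].
    unfold Rdiv. apply Rmult_le_compat_l; [lra |].
    apply Rinv_le_contravar; [nra |].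
    apply Rmult_le_compat_r; nra.
Qed.

Lemma iter_contraction (f : R -> R) k c x :
  0 <= c < 1 ->
  (forall x, k < x -> k < f x /\ f x - k <= c * (x - k)) -> k < x ->
  (forall n, k < Nat.iter n f x) /\ Un_cv (fun n => Nat.iter n f x) k.
Proof.
  intros Hc Hf Hx.
  assert (B : forall n, k < Nat.iter n f x /\
    Nat.iter n f x - k <= c ^ n * (x - k)).
  { induction n as [| n [IH1 IH2]]; cbn; [lra |].
    destruct (Hf _ IH1) as [? Hn]. split; [assumption |].
    apply Rle_trans with (1 := Hn). rewrite Rmult_assoc.
    apply Rmult_le_compat_l; lra. }
  split; [apply B |].
  intros e He.
  destruct (pow_lt_1_zero c) with (y := e / (x - k)) as [N HN].
  - rewrite Rabs_pos_eq; lra.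
  - apply Rdiv_lt_0_compat; lra.
  - exists N. intros n Hn. specialize (HN n Hn). destruct (B n).
    unfold Rdist. rewrite Rabs_pos_eq by lra.
    rewrite Rabs_pos_eq in HN by (apply pow_le; lra).
    apply Rle_lt_trans with (c ^ n * (x - k)); [assumption |].
    apply (Rmult_lt_compat_r (x - k)) in HN; [| lra].
    unfold Rdiv in HN. rewrite Rmult_assoc, Rinv_l in HN; lra.
Qed.

(** The crossing is strict because case I includes [p1 - x = transport]: a
    second price equal to [m = p1 - transport] falls once more. *)
Lemma first_crossing (u : nat -> R) m n :
  m <= u 0%nat -> u n < m ->
  exists s, (1 <= s)%nat /\ u s < m /\ forall t, (t < s)%nat -> m <= u t.
Proof.
  intros H0 Hn.
  assert (D : (exists s, (1 <= s)%nat /\ u s < m /\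
      forall t, (t < s)%nat -> m <= u t) \/
    forall t, (t <= n)%nat -> m <= u t).
  { clear Hn. induction n as [| n [C | IH]].
    - right. intros t Ht. now replace t with 0%nat by lia.
    - now left.
    - destruct (Rlt_or_le (u (S n)) m) as [L | L].
      + left. exists (S n). split; [lia |]. split; [exact L |].
        intros t Ht. apply IH. lia.
      + right. intros t Ht.
        destruct (Nat.eq_dec t (S n)) as [-> |]; [exact L | apply IH; lia]. }
  destruct D as [C | D]; [exact C |].
  specialize (D n (Nat.le_refl n)). lra.
Qed.

Lemma strictly_decreasing_lt (u : nat -> R) :
  (forall n, u (S n) < u n) -> forall m n, (m < n)%nat -> u n < u m.
Proof.
  intros H m n L. induction L; [apply H |].
  eapply Rlt_trans; [apply H | assumption].
Qed.
(** * The equilibrium points that are reached *)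

(** On [l3] the two incomes together pay for both supplies, so the bundle of the
    equilibrium above [l3] exhausts the budgets as well as the supplies. *)
Lemma equilibrium_on_l3 E p :
  positive_economy E -> closed_zone_IV E p ->
  on_l3 E p (income1 E) (income2 E) -> equilibrium_point E p.
Proof.
  intros HE Hp L.
  apply on_l3_leftover2 in L; [| apply Hp].
  pose proof (unique_NE_above_l3 E p HE Hp (Req_le _ _ L)) as U.
  destruct Hp as (? & ? & ? & ?).
  split; [lra |]. split; [lra |].
  eexists; split; [exact U |].
  unfold clears; cbn. repeat split; try lra.
  - unfold leftover2; lra.
  - field; lra.
Qed.

(** Along these adjustments [price2], and with it the leftover, is unchanged,
    and the new [price1] is the solution of the equation of [l3] in which
    everything else is fixed. *)
Lemma l3_reached E p :
  positive_economy E -> closed_zone_IV E p ->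
  price2' E p * leftover2 E p <= income1 E ->
  let p' := Prices ((income1 E - price2' E p * leftover2 E p) / supply1 E)
                   (price2 p) in
  closed_zone_IV E p' /\ on_l3 E p' (income1 E) (income2 E).
Proof.
  intros HE Hp L p'.
  pose proof (leftover2_bounds E p HE Hp).
  destruct HE as (? & ? & ? & ?). destruct Hp as (? & ? & ? & ?).
  assert (Ep : price1 p' * supply1 E = income1 E - price2' E p * leftover2 E p)
    by (cbn; field; lra).
  assert (0 < price2' E p) by (unfold price2'; lra).
  assert (0 <= price2' E p * leftover2 E p) by (apply Rmult_le_pos; lra).
  split.
  - split; [apply (Rmult_le_reg_r (supply1 E)); lra |].
    change (price2 p') with (price2 p). repeat split; lra.
  - apply on_l3_leftover2; [assumption |].
    change (price2' E p') with (price2' E p).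
    change (leftover2 E p') with (leftover2 E p). lra.
Qed.

Lemma l3_equilibrium_reached E p :
  positive_economy E -> closed_zone_IV E p ->
  income2 E < price2 p * supply2 E ->
  price2' E p * leftover2 E p <= income1 E ->
  let p' := Prices ((income1 E - price2' E p * leftover2 E p) / supply1 E)
                   (price2 p) in
  on_l3 E p' (income1 E) (income2 E) /\ l3_equilibrium E p'.
Proof.
  intros HE Hp H2 L p'.
  destruct (l3_reached E p HE Hp L) as [C O]. fold p' in C, O.
  pose proof (equilibrium_on_l3 E p' HE C O).
  destruct C as (? & ? & ? & ?). unfold l3_equilibrium. tauto.
Qed.

(** Here the leftover is zero, so [l3] passes through the incomes
    [(price1 * supply1, price2 * supply2)]. *)
Lemma equilibrium_E_reached E p1 :
  positive_economy E -> 0 < p1 -> income1 E = p1 * supply1 E ->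
  equilibrium_E E (Prices p1 (income2 E / supply2 E)).
Proof.
  intros HE Hp H1. pose proof HE as (? & ? & ? & ?).
  set (p := Prices p1 (income2 E / supply2 E)).
  assert (0 < price2 p) by (cbn; apply Rdiv_lt_0_compat; lra).
  assert (E2 : price2 p * supply2 E = income2 E) by (cbn; field; lra).
  assert (C : closed_zone_IV E p)
    by (unfold closed_zone_IV; cbn [price1 p]; lra).
  assert (D : income2 E / price2 p = supply2 E) by (cbn; field; lra).
  assert (R0 : leftover2 E p = 0) by (unfold leftover2; lra).
  assert (L : price1 p * supply1 E + price2' E p * leftover2 E p = income1 E)
    by (rewrite R0; cbn; lra).
  split; [| split; [cbn; rewrite H1; field; lra | split; [reflexivity |]]].
  - apply equilibrium_on_l3; trivial. now apply on_l3_leftover2.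
  - pose proof (unique_NE_above_l3 E p HE C (Req_le _ _ L)) as U.
    now rewrite D, R0 in U.
Qed.

(** * The two fates of case I *)

Lemma next_price2_fixpoint E p1 k :
  positive_economy E -> 0 < k ->
  next_price2 E p1 k = k <->
  supply2 E * k ^ 2
    + (transport E * supply2 E - income1 E - income2 E + p1 * supply1 E) * k
  = transport E * income2 E.
Proof.
  intros (? & ? & ? & ?) Hk.
  assert (D : 0 < supply2 E * (k + transport E))
    by (apply Rmult_lt_0_compat; lra).
  assert (I : (k - next_price2 E p1 k) * (supply2 E * (k + transport E))
    = supply2 E * k ^ 2
      + (transport E * supply2 E - income1 E - income2 E + p1 * supply1 E) * k
      - transport E * income2 E) by (unfold next_price2; field; lra).
  split; intros; nra.
Qed.

Lemma next_price2_decreases E p1 k x :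
  positive_economy E -> p1 * supply1 E < income1 E ->
  0 < k -> next_price2 E p1 k = k -> k < x -> next_price2 E p1 x < x.
Proof.
  intros HE H1 Hk Fk Hx.
  destruct (next_price2_contracts E p1 k HE H1 Hk Fk) as (c & Hc & Hf).
  destruct (Hf x Hx). nra.
Qed.

Lemma income2_below_fixpoint E p1 k :
  positive_economy E -> p1 * supply1 E <= income1 E -> 0 < k ->
  next_price2 E p1 k = k -> income2 E <= k * supply2 E.
Proof.
  intros (? & ? & ? & ?) HA Hk Fk. rewrite <- Fk. unfold next_price2.
  assert (0 < k / (k + transport E)) by (apply Rdiv_lt_0_compat; lra).
  set (w := k / (k + transport E)) in *.
  replace (1 / supply2 E * (income2 E + (income1 E - p1 * supply1 E) * w)
    * supply2 E) with (income2 E + (income1 E - p1 * supply1 E) * w)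
    by (field; lra).
  nra.
Qed.

(** As long as the second price stays above the fixed point [k], the incomes
    stay in zone IV and strictly below [l3]; only the price order can end
    case I. *)
Lemma lowering_step E p1 k x p' :
  positive_economy E -> 0 < p1 -> p1 * supply1 E < income1 E ->
  0 < k -> next_price2 E p1 k = k -> k < x -> p1 <= x + transport E ->
  price_step E (Prices p1 x) p' <-> p' = Prices p1 (next_price2 E p1 x).
Proof.
  intros HE Hp H1 Hk Fk Hx Hd.
  pose proof (next_price2_decreases E p1 k x HE H1 Hk Fk Hx).
  pose proof (income2_below_fixpoint E p1 k HE (Rlt_le _ _ H1) Hk Fk).
  pose proof HE as (? & ? & ? & ?).
  apply (step_case_I E (Prices p1 x)); trivial.
  - unfold closed_zone_IV; cbn. repeat split; nra.
  - unfold price2'; cbn. lra.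
  - apply below_l3_next_price2; cbn; trivial; nra.
Qed.

(** The orbit stays above [k >= p1 - transport], so case I never ends.  The
    fixed-point equation at [k], cleared of denominators, is the equation of
    [l3] at the limit prices. *)
Lemma tends_to_fixpoint E p1 k x :
  positive_economy E -> 0 < p1 -> p1 * supply1 E < income1 E ->
  0 < k -> next_price2 E p1 k = k -> k < x -> p1 - transport E <= k ->
  along_infinite_path E (Prices p1 x) (fun P =>
    (forall t, downward2 (P t) (P (S t))) /\
    Un_cv (fun t => price2 (P t)) k /\
    tends_to_degenerate_l3_equilibrium E P (Prices p1 k)).
Proof.
  intros HE Hp H1 Hk Fk Hx Hd.
  destruct (next_price2_contracts E p1 k HE H1 Hk Fk) as (c & Hc & Hf).
  destruct (iter_contraction _ _ _ _ Hc Hf Hx) as [B L].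
  set (u := fun t => Nat.iter t (next_price2 E p1) x) in *.
  assert (Dec : forall t, u (S t) < u t).
  { intros t. apply (next_price2_decreases E p1 k); trivial. apply B. }
  apply (along_infinite_path_intro E (fun t => Prices p1 (u t))).
  - intros t p'. apply (lowering_step E p1 k); trivial; [apply B |].
    specialize (B t). fold (u t) in B. lra.
  - intros P HP.
    assert (L2 : Un_cv (fun t => price2 (P t)) k).
    { apply Un_cv_ext with (un := u); [intros t; now rewrite HP | exact L]. }
    assert (D : forall t, downward2 (P t) (P (S t))).
    { intros t. rewrite !HP. split; [reflexivity | apply Dec]. }
    split; [exact D |]. split; [exact L2 |].
    split; [| split; [| split; [exact L2 |]]].
    + intros t Eq. destruct (D t) as [_ Lt]. rewrite Eq in Lt. lra.
    + apply Un_cv_ext with (un := fun _ => p1); [intros t; now rewrite HP |].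
      intros e He. exists 0%nat. intros. now rewrite Rdist_eq.
    + apply next_price2_fixpoint in Fk; trivial.
      unfold on_l3, price2'; cbn.
      apply (Rmult_eq_reg_r k); [| lra].
      replace ((income1 E + (k + transport E) / k * income2 E) * k)
        with (income1 E * k + (k + transport E) * income2 E) by (field; lra).
      nra.
Qed.

Lemma l3_line_scaled E p1 k z1 z2 :
  0 < k -> 0 < transport E ->
  on_l3 E (Prices p1 k) z1 z2 <->
  k / (k + transport E) * z1 + z2
  = k * supply2 E + k / (k + transport E) * p1 * supply1 E.
Proof.
  intros Hk Hr. unfold on_l3, price2'; cbn.
  assert (W : 0 < k / (k + transport E)) by (apply Rdiv_lt_0_compat; lra).
  assert (I : k / (k + transport E) *
      (p1 * supply1 E + (k + transport E) * supply2 E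
       - (z1 + (k + transport E) / k * z2))
    = k * supply2 E + k / (k + transport E) * p1 * supply1 E
      - (k / (k + transport E) * z1 + z2)) by (field; lra).
  split; intros G; nra.
Qed.

(** The orbit converges to [k < p1 - transport], so it has a first index [s]
    below [p1 - transport]; until then case I persists, and at [s] only the
    price order has changed.  Strict monotonicity of the orbit leaves [s - 1]
    as the only other index whose interval can contain
    [p1 - transport]. *)
Lemma reaches_case_II E p1 k x :
  positive_economy E -> 0 < p1 -> p1 * supply1 E < income1 E ->
  0 < k -> next_price2 E p1 k = k -> k < x ->
  x * supply2 E < p1 * supply1 E -> k < p1 - transport E <= x ->
  let u := fun t => Nat.iter t (next_price2 E p1) x in
  let in_interval := fun s : nat =>
    u s <= p1 - transport E <= u (s - 1)%nat in
  exists s : nat,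
    (1 <= s)%nat /\ in_interval s /\
    (forall s' : nat, (1 <= s')%nat -> in_interval s' ->
       s' = s \/ (s = S s' /\ p1 - transport E = u s')) /\
    after_steps E s (Prices p1 x) (fun P =>
      (forall t, (t < s)%nat -> downward2 (P t) (P (S t))) /\
      case_II E (P s)).
Proof.
  intros HE Hp H1 Hk Fk Hx Hq Hd u in_interval.
  destruct (next_price2_contracts E p1 k HE H1 Hk Fk) as (c & Hc & Hf).
  destruct (iter_contraction _ _ _ _ Hc Hf Hx) as [B L].
  assert (B' : forall t, k < u t) by exact B.
  assert (Dec : forall t, u (S t) < u t).
  { intros t. now apply (next_price2_decreases E p1 k). }
  pose proof (strictly_decreasing_lt u Dec) as Mono.
  assert (exists n, u n < p1 - transport E) as [n Hn].
  { destruct (L (p1 - transport E - k)) as [N HN]; [lra |].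
    exists N. specialize (HN N (Nat.le_refl N)). specialize (B' N).
    fold (u N) in HN. unfold Rdist in HN. rewrite Rabs_pos_eq in HN; lra. }
  destruct (first_crossing u (p1 - transport E) n) as (s & Hs & Us & Ut);
    [cbn; lra | exact Hn |].
  assert (Us' : p1 - transport E <= u (s - 1)%nat) by (apply Ut; lia).
  exists s. split; [exact Hs |]. split; [split; lra | split].
  - intros s' Hs' [I1 I2].
    destruct (Compare_dec.lt_eq_lt_dec s' s) as [[Lt | Eq] | Gt].
    (* Before the first crossing the orbit is at least [p1 - transport], so
       membership forces equality, and by monotonicity this happens only at
       [s - 1]. *)
    + right. specialize (Ut s' Lt).
      assert (Es : p1 - transport E = u s') by lra.
      split; [| exact Es].
      destruct (Nat.eq_dec s (S s')) as [| Ne]; [assumption | exfalso].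
      specialize (Mono s' (s - 1)%nat ltac:(lia)). lra.
    + now left.
    + exfalso. destruct (Nat.eq_dec (s' - 1) s) as [Eq | Ne].
      * rewrite Eq in I2. lra.
      * specialize (Mono s (s' - 1)%nat ltac:(lia)). lra.
  - apply (after_steps_intro E s (fun t => Prices p1 (u t))).
    + intros t Ht p'. apply (lowering_step E p1 k); trivial.
      specialize (Ut t Ht). lra.
    + intros P HP. split.
      * intros t Ht. rewrite !HP by lia. split; [reflexivity | apply Dec].
      * rewrite HP by lia.
        pose proof HE as (? & ? & ? & ?).
        pose proof (income2_below_fixpoint E p1 k HE (Rlt_le _ _ H1) Hk Fk).
        specialize (B' s). specialize (Mono 0%nat s Hs).
        specialize (Dec s).
        change (u 0%nat) with x in Mono.
        change (u (S s)) with (next_price2 E p1 (u s)) in Dec.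
        unfold case_II, zone_IV_2, zone_IV; cbn [price1 price2].
        repeat split; try nra.
        apply (below_l3_zone_IV_2 E (Prices p1 (u s))); [assumption |].
        now apply below_l3_next_price2; cbn [price1 price2]; trivial; lra.
Qed.

(** * The adjustment patterns in zone IV *)

Theorem proposition4p5 :
  forall q1 q2 Y1 Y2 rho p10 p20 : R,
  0 < q1 -> 0 < q2 -> 0 < Y1 -> 0 < Y2 -> 0 < rho ->
  0 < p10 -> 0 < p20 ->
  p20 * q2 < p10 * q1 ->
  let E := Economy q1 q2 Y1 Y2 rho in
  let P0 := Prices p10 p20 in
  zone_IV E P0 ->
  (* a) *)
  (zone_IV_1 E P0 ->
     unique (NE E P0) (Orders q1 (q2 - Y2 / p20) 0 (Y2 / p20)) /\
     ((on_l3 E P0 Y1 Y2 /\ equilibrium_point E P0) \/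
      (above_l3 E P0 Y1 Y2 /\
       after_one_step E P0 (fun P1 =>
         upward1 P0 P1 /\ on_l3 E P1 Y1 Y2 /\ l3_equilibrium E P1))))
  /\
  (* b) types of NE; the second quadruple has alpha >= 0 only on or above l2 *)
  (case_I E P0 ->
     unique (NE E P0)
       (Orders q1 ((Y1 - p10 * q1) / (p20 + rho)) 0 (Y2 / p20)))
  /\
  (case_II E P0 ->
     on_l2 E P0 Y1 Y2 \/ above_l2 E P0 Y1 Y2 ->
     unique (NE E P0)
       (Orders ((Y1 - (p20 + rho) * (q2 - Y2 / p20)) / p10)
               (q2 - Y2 / p20) 0 (Y2 / p20)))
  /\
  (* case II) *)
  (case_II E P0 ->
     (above_l2 E P0 Y1 Y2 ->
        after_one_step E P0 (fun P1 =>
          downward1 P0 P1 /\ l3_equilibrium E P1)) /\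
     (on_l2 E P0 Y1 Y2 ->
        after_one_step E P0 (fun P1 =>
          downward1 P0 P1 /\ price1 P1 = 0 /\
          degenerate_l2_equilibrium E P1)))
  /\
  (* case I) *)
  (case_I E P0 ->
     (Y1 = p10 * q1 ->
        after_one_step E P0 (fun P1 =>
          downward2 P0 P1 /\ equilibrium_E E P1)) /\
     (p10 * q1 < Y1 ->
        let b := rho * q2 - Y1 - Y2 + p10 * q1 in
        let k := 1 / (2 * q2) * (sqrt (b ^ 2 + 4 * q2 * rho * Y2) - b) in
        let g := fun x => 1 / q2 * (Y2 + (Y1 - p10 * q1) * (x / (x + rho))) in
        let in_interval := fun s : nat =>
          Nat.iter s g p20 <= p10 - rho <= Nat.iter (s - 1) g p20 in
        (* 2.1) *)
        (p10 - rho <= k < p20 ->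
           along_infinite_path E P0 (fun P =>
             (forall t, downward2 (P t) (P (S t))) /\
             Un_cv (fun t => price2 (P t)) k /\
             tends_to_degenerate_l3_equilibrium E P (Prices p10 k)) /\
           (forall z1 z2 : R,
              on_l3 E (Prices p10 k) z1 z2 <->
              k / (k + rho) * z1 + z2 = k * q2 + k / (k + rho) * p10 * q1)) /\
        (* 2.2); the condition determines s, except that at a common endpoint
           of two consecutive intervals the larger index is meant *)
        (k < p10 - rho < p20 ->
           exists s : nat,
             (1 <= s)%nat /\ in_interval s /\
             (forall s' : nat, (1 <= s')%nat -> in_interval s' ->
                s' = s \/ (s = S s' /\ p10 - rho = Nat.iter s' g p20)) /\
             after_steps E s P0 (fun P =>
               (forall t, (t < s)%nat -> downward2 (P t) (P (S t))) /\
               case_II E (P s))))).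

Proof.
  intros q1 q2 Y1 Y2 rho p10 p20 Hq1 Hq2 HY1 HY2 Hrho Hp1 Hp2 Hord E P0 HZ.
  assert (HE : positive_economy E) by (repeat split; assumption).
  assert (C : closed_zone_IV E P0)
    by (unfold zone_IV in HZ; unfold closed_zone_IV; cbn in *; lra).
  assert (H2' : 0 < price2' E P0) by (unfold price2'; cbn; lra).
  assert (HI : case_I E P0 ->
    0 < price1 P0 <= price2' E P0 /\
    income1 E < price1 P0 * supply1 E + price2' E P0 * leftover2 E P0).
  { intros (_ & _ & _ & [_ L] & D).
    apply below_l3_zone_IV_2 in L; [| exact Hp1].
    split; [unfold price2'; cbn in *; lra | exact L]. }
  assert (HII : case_II E P0 ->
    price2' E P0 < price1 P0 /\
    income1 E < price1 P0 * supply1 E + price2' E P0 * leftover2 E P0).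
  { intros (_ & _ & _ & [_ L] & D).
    apply below_l3_zone_IV_2 in L; [| exact Hp1].
    split; [unfold price2'; cbn in *; lra | exact L]. }
  split; [| split; [| split; [| split]]].
  - intros [_ A].
    assert (L : price1 P0 * supply1 E + price2' E P0 * leftover2 E P0 <= income1 E).
    { apply Rnot_lt_le. intros L.
      apply below_l3_zone_IV_2 in L; [lra | exact Hp1]. }
    split; [exact (unique_NE_above_l3 E P0 HE C L) |].
    destruct L as [L | L].
    + right. split; [now apply (above_l3_leftover2 E) |].
      eapply after_one_step_intro; [intros p'; now apply step_above_l3 |].
      pose proof (leftover2_bounds E P0 HE C).
      destruct (l3_equilibrium_reached E P0 HE C) as [O Q];
        [apply HZ | unfold P0, E in *; cbn in *; nra |].
      split; [split; [| reflexivity] | split; assumption].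
      apply (Rmult_lt_reg_r (supply1 E)); [exact Hq1 |].
      cbn [price1]. unfold Rdiv. rewrite Rmult_assoc, Rinv_l; cbn in *; lra.
    + assert (O : on_l3 E P0 (income1 E) (income2 E))
        by now apply on_l3_leftover2.
      left. split; [exact O | now apply equilibrium_on_l3].
  - intros H. destruct (HI H). now apply (unique_NE_case_I E P0).
  - intros H L. destruct (HII H).
    apply (unique_NE_case_II E P0); trivial. split; [| assumption].
    destruct L as [L | L].
    + apply Req_le. now apply (on_l2_leftover2 E).
    + apply Rlt_le. now apply (above_l2_leftover2 E).
  - intros H. destruct (HII H) as [D L].
    assert (Dn : downward1 P0
      (Prices ((income1 E - price2' E P0 * leftover2 E P0) / supply1 E) (price2 P0))).
    { split; [| reflexivity].
      apply (Rmult_lt_reg_r (supply1 E)); [exact Hq1 |].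
      cbn [price1]. unfold Rdiv. rewrite Rmult_assoc, Rinv_l; cbn in *; lra. }
    split; intros A.
    + apply (above_l2_leftover2 E P0 H2') in A.
      eapply after_one_step_intro;
        [intros p'; apply step_case_II; trivial; lra |].
      split; [exact Dn |].
      apply l3_equilibrium_reached; trivial; [apply HZ | lra].
    + apply (on_l2_leftover2 E P0 H2') in A.
      assert (A' : price2' E P0 * leftover2 E P0 <= income1 E) by lra.
      eapply after_one_step_intro;
        [intros p'; apply step_case_II; trivial; lra |].
      destruct (l3_reached E P0 HE C A') as [C1 O1].
      assert (Z : (income1 E - price2' E P0 * leftover2 E P0) / supply1 E = 0)
        by (rewrite A; unfold Rdiv; ring).
      split; [exact Dn |]. split; [exact Z |].
      split; [now apply equilibrium_on_l3 |].
      split; [exact Z |]. split; [exact Hp2 |].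
      now apply (on_l2_leftover2 E).
  - intros H. destruct (HI H) as [D L]. split.
    + intros E1.
      eapply after_one_step_intro; [intros p'; now apply step_case_I |].
      assert (Ex : next_price2 E (price1 P0) (price2 P0) = income2 E / supply2 E)
        by (unfold next_price2; cbn; rewrite E1; field; lra).
      split; [split; [reflexivity |] |].
      * now apply below_l3_next_price2.
      * rewrite Ex. now apply equilibrium_E_reached.
    + intros A b k g in_interval.
      destruct (limit_price_root q2 b (rho * Y2) Hq2) as [Hk Rk];
        [now apply Rmult_lt_0_compat |].
      replace (4 * q2 * (rho * Y2)) with (4 * q2 * rho * Y2) in Hk, Rk by ring.
      fold k in Hk, Rk.
      assert (Fk : next_price2 E p10 k = k) by now apply next_price2_fixpoint.
      split.
      * intros [K1 K2]. split.
        -- now apply (tends_to_fixpoint E).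
        -- intros z1 z2. now apply (l3_line_scaled E).
      * intros [K1 K2]. destruct H as (_ & _ & _ & _ & H).
        apply (reaches_case_II E p10 k p20); trivial; cbn in *; lra.
Qed.
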